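(* In the supersample setting described in the context, let $\Gamma\subseteq\mathbb R$ be the range of the loss difference $\Delta L_i$ and, for each $i$, consider the random process $\{\mathrm{Err}^i(\delta)\}_{\delta\in\Gamma}$ with $\mathrm{Err}^i(\delta)=(-1)^{U_i}\delta$. For each $i\in\{1,\dots,n\}$ assume $\{\Delta L_{i,k}\}_{k=k_0}^\infty$ is a stochastic chain of the pair $(\{\mathrm{Err}^i(\delta)\}_{\delta\in\Gamma},\Delta L_i)$. Then \[ \mathrm{Err}\leq \frac{1}{n}\sum_{i=1}^n\sum_{k=k_0+1}^\infty\sqrt{2\,\mathbb E\!\left[|\Delta L_{i,k}-\Delta L_{i,k-1}|^2\right]I(\Delta L_{i,k};U_i)}, \] where the expectation is over $(\Delta L_{i,k},\Delta L_{i,k-1})$.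
   Context: Let $\mathcal Z=\mathcal X\times\mathcal Y$ and let $\mu$ be a distribution on $\mathcal Z$. A (possibly randomized) learning algorithm $\mathcal A$ maps a training sample in $\mathcal Z^n$ to a hypothesis $W\in\mathcal W$, and $\ell:\mathcal W\times\mathcal Z\to[0,\infty)$ is a loss (not assumed bounded). For $S=(Z_1,\dots,Z_n)\sim\mu^{n}$ and $W\sim P_{W|S}$, let $L_\mu=\mathbb E_W\mathbb E_{Z'\sim\mu}[\ell(W,Z')]$ (with $Z'$ independent of $(S,W)$), $L_n=\mathbb E_{W,S}[\frac1n\sum_i\ell(W,Z_i)]$, $\mathrm{Err}=L_\mu-L_n$. Supersample: $\widetilde Z=(\widetilde Z_{i,j})_{i\in\{1,\dots,n\},j\in\{0,1\}}$ with i.i.d. entries of law $\mu$; $U=(U_1,\dots,U_n)$ uniform on $\{0,1\}^n$, independent of $\widetilde Z$; $W=\mathcal A(\widetilde Z_U)$ with $\widetilde Z_U=(\widetilde Z_{1,U_1},\dots,\widetilde Z_{n,U_n})$. Put $L_{i,j}=\ell(W,\widetilde Z_{i,j})$ and $\Delta L_i=L_{i,1}-L_{i,0}$. Stochastic chain: for a random process $\{X_t\}_{t\in\mathcal T}$ and a random variable $T$ in $\mathcal T$, a sequence of $\mathcal T$-valued random variables $\{T_k\}_{k=k_0}^\infty$ is a stochastic chain of $(\{X_t\},T)$ if (1) $\lim_{k\to\infty}\mathbb E[X_{T_k}]=\mathbb E[X_T]$; (2) $\mathbb E[X_{T_{k_0}}]=0$; (3) $\{X_t\}_{t\in\mathcal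 T}-T-T_k-T_{k-1}$ is a Markov chain for every $k>k_0$. Mutual information is in nats. *)

(* Defs.v *)
From HB Require Import structures.
From mathcomp Require Import all_boot all_order all_algebra.
From mathcomp Require Import all_classical all_reals all_analysis.
Set Implicit Arguments. Unset Strict Implicit. Unset Printing Implicit Defensive.
Import Order.TTheory GRing.Theory Num.Theory.
Local Open Scope classical_set_scope.
Local Open Scope ring_scope.

Section Defs.
Context {R : realType} {d : measure_display} {Omega : measurableType d}.
Variable P : probability Omega R.

Definition mutually_independent (K : finType) (F : K -> set (set Omega)) :=
  forall (J : {set K}) (E : K -> set Omega), (forall k, k \in J -> F k (E k)) ->
    fine (P (\bigcap_(k in [set k | k \in J]) E k)) = \prod_(k in J) fine (P (E k)).

Definition sigma_rv {dT} {T : measurableType dT} (X : Omega -> T) : set (set Omega) :=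
  preimage_set_system setT X measurable.

Definition sgnb (b : bool) : R := if b then -1 else 1.

Definition proc_events (Gamma : set R) (V : Omega -> bool) : set (set Omega) :=
  <<s \bigcup_(t in Gamma) sigma_rv (fun w => sgnb (V w) * t) >>.

(** Markov chain  F1 - T - S - V  (F1 the events of the first random element):
    the conditional law of each element given all the previous ones is a
    probability kernel of the immediately preceding one. *)
Definition markov4 (F1 : set (set Omega)) (T S V : Omega -> R) :=
  (exists k : R.-pker R ~> R, forall A B C, F1 A -> measurable B -> measurable C ->
     P (A `&` T @^-1` B `&` S @^-1` C) =
     (\int[P]_(w in A `&` T @^-1` B) k (T w) C)%E) /\
  (exists k : R.-pker R ~> R, forall A B C D, F1 A -> measurable B ->
     measurable C -> measurable D ->
     P (A `&` T @^-1` B `&` S @^-1` C `&` V @^-1` D) =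
     (\int[P]_(w in A `&` T @^-1` B `&` S @^-1` C) k (S w) D)%E).

Definition stochastic_chain (Gamma : set R) (V : Omega -> bool) (T : Omega -> R)
    (k0 : nat) (Tc : nat -> Omega -> R) :=
  (forall k, (k0 <= k)%N -> forall w, Gamma (Tc k w)) /\
  ((fun k => (\int[P]_w (sgnb (V w) * Tc k w)%:E)%E) @ \oo -->
     (\int[P]_w (sgnb (V w) * T w)%:E)%E) /\
  (\int[P]_w (sgnb (V w) * Tc k0 w)%:E = 0)%E /\
  (forall k, (k0 < k)%N -> markov4 (proc_events Gamma V) T (Tc k) (Tc k.-1)).

Definition mi_partition (X : Omega -> R) (V : Omega -> bool) (m : nat)
    (B : 'I_m -> set R) : R :=
  \sum_(j < m) \sum_(b : bool)
    let pjb := fine (P (X @^-1` B j `&` V @^-1` [set b])) in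
    let pj := fine (P (X @^-1` B j)) in
    let qb := fine (P (V @^-1` [set b])) in
    if pjb == 0 then 0 else pjb * ln (pjb / (pj * qb)).

Definition mutual_info (X : Omega -> R) (V : Omega -> bool) : \bar R :=
  ereal_sup [set x | exists m (B : 'I_m -> set R),
    [/\ forall j, measurable (B j), trivIset setT B,
        \bigcup_(j in setT) B j = setT & x = (mi_partition X V B)%:E]].

End Defs.

Section Supersample.
Context {R : realType} {d : measure_display} {Omega : measurableType d}.
Context {dZ dW dS : measure_display} {Z : measurableType dZ}
  {Wsp : measurableType dW} {Seed : measurableType dS} {n : nat}.
Variables (P : probability Omega R) (mu : probability Z R).
Variables (A : n.-tuple Z -> Seed -> Wsp) (loss : Wsp -> Z -> R).
Variables (Zt : 'I_n -> bool -> Omega -> Z) (U : 'I_n -> Omega -> bool)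
  (Rs : Omega -> Seed).

Definition train_sample (w : Omega) : n.-tuple Z := [tuple Zt i (U i w) w | i < n].

Definition hyp (w : Omega) : Wsp := A (train_sample w) (Rs w).

Definition DeltaL (i : 'I_n) (w : Omega) : R :=
  loss (hyp w) (Zt i true w) - loss (hyp w) (Zt i false w).

Definition L_mu : \bar R := (\int[P]_w \int[mu]_z (loss (hyp w) z)%:E)%E.

Definition L_n : \bar R :=
  (\int[P]_w (n%:R^-1 * \sum_(i < n) loss (hyp w) (Zt i (U i w) w))%:E)%E.

Definition Err : R := fine L_mu - fine L_n.

Definition ss_family (k : ('I_n * bool) + ('I_n + unit)) : set (set Omega) :=
  match k with
  | inl (i, j) => sigma_rv (Zt i j)
  | inr (inl i) => sigma_rv (U i)
  | inr (inr _) => sigma_rv Rs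
  end.

End Supersample.

(* Main.v *)
(** Since the test point of index [i] is independent of the hypothesis,
    [Err = n^-1 sum_i E[(-1)^(U_i) DeltaL_i]], and along the chain each summand
    telescopes into the increments [E[(-1)^(U_i) (T_k - T_(k-1))]].

    An increment [Y = T_k - T_(k-1)] is controlled by the Donsker-Varadhan bound
    [E[(-1)^U f(S) - f(S)^2 / 2] <= I(S; U)], i.e. the sub-Gaussianity of a fair
    sign ([cosh x <= exp (x^2 / 2)]) inserted in the variational formula of the
    relative entropy, cell by cell of a finite partition. With [S = T_k], the
    Markov property replaces [Y] by [f(S) = E[Y | S]], and Jensen's inequality
    gives [E[f(S)^2] <= E[Y^2]]. Replacing [Y] by [t Y] and optimising over [t]
    yields the square root. All conditional expectations are taken after
    discretising [T_k] and [T_(k-1)], so that they are finite sums over the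
    values of the Markov kernel. *)
Require Import Defs.
From HB Require Import structures.
From mathcomp Require Import all_boot all_order all_algebra.
From mathcomp Require Import all_classical all_reals all_analysis.
From mathcomp Require Import measurable_realfun.
From mathcomp Require Import ring lra.
Import Order.TTheory GRing.Theory Num.Theory.
Import numFieldNormedType.Exports.
Local Open Scope classical_set_scope.
Local Open Scope ring_scope.

Set Implicit Arguments.
Unset Strict Implicit.
Unset Printing Implicit Defensive.

(** * Two scalar inequalities: sub-Gaussianity of a fair sign and entropy duality *)

(** By symmetry [x >= 0] may be assumed. The quotient [c y] of the two sides (up to the factor 2)
    has derivative [- s y * expR (- (y ^+ 2 / 2))], where [s 0 = 0] and [s' >= 0] on the half-line.
    Hence [c] is nonincreasing there and [c x <= c 0 = 2]. *)
Lemma cosh_le_expR_sqr (R : realType) (x : R) :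
  (expR x + expR (- x)) / 2 <= expR (x ^+ 2 / 2).
Proof.
wlog x0 : x / 0 <= x.
  move=> H; have [/H//|/ltW x0] := leP 0 x.
  by have := H (- x); rewrite opprK sqrrN addrC; apply; rewrite oppr_ge0.
pose s (y : R) := (y - 1) * expR y + (y + 1) * expR (- y).
pose s' (y : R) := y * (expR y - expR (- y)).
have ds (z : R) : is_derive z 1 s (s' z).
  by apply: is_derive_eq; rewrite /s' /GRing.scale/=; ring.
have cont (f f' : R -> R) : (forall z : R, is_derive z 1 f (f' z)) ->
    {within `[0, +oo[, continuous f}.
  move=> df; apply: derivable_within_continuous => z _.
  by have := df z => -[].
have s_ge0 y : 0 <= y -> 0 <= s y.
  move=> y0; have -> : 0 = s 0 by rewrite /s oppr0 expR0; ring.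
  apply: (@ger0_derive1_ndecry _ s 0) => //; last exact: (cont s s').
  move=> z /[!in_itv]/= /[!andbT] z0; rewrite derive1E derive_val /s'.
  by rewrite (mulr_ge0 (ltW z0))// subr_ge0 ler_expR; lra.
pose c (y : R) := (expR y + expR (- y)) * expR (- (y ^+ 2 / 2)).
pose c' (y : R) := - s y * expR (- (y ^+ 2 / 2)).
have dc (z : R) : is_derive z 1 c (c' z).
  by apply: is_derive_eq; rewrite /c' /s /GRing.scale/=; field.
have : c x <= c 0.
  apply: (@ler0_derive1_nincry _ c 0) => //; last exact: (cont c c').
  move=> z /[!in_itv]/= /[!andbT] z0; rewrite derive1E derive_val /c' mulNr.
  by rewrite oppr_le0 mulr_ge0 ?expR_ge0// s_ge0// ltW.
rewrite /c oppr0 expR0 expr0n/= mul0r oppr0 expR0 mulr1 (expRN (x ^+ 2 / 2)).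
by rewrite ler_pdivrMr ?expR_gt0// ler_pdivrMr//; lra.
Qed.

(** This is [ln z <= z - 1] at [z = b * expR t / a], multiplied by [a]. It is the Donsker-Varadhan
    bound for one cell of mass [a] and reference mass [b], in the linear form without the logarithm
    of an expectation, so that it can be summed over cells. *)
Lemma xlnx_young (R : realType) (a b t : R) : 0 < a -> 0 < b ->
  a * (1 + t) - b * expR t <= a * ln (a / b).
Proof.
move=> a0 b0; have e0 := expR_gt0 t.
have : ln (b * expR t / a) <= b * expR t / a - 1.
  rewrite -[X in ln X](subrKC 1) le_ln1Dx// ltrBDl addrN.
  by rewrite divr_gt0// mulr_gt0.
have -> : ln (b * expR t / a) = - ln (a / b) + t.
  have -> : b * expR t / a = (a / b)^-1 * expR t by rewrite invf_div mulrAC.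
  have ab0 : 0 < a / b by rewrite divr_gt0.
  by rewrite (@lnM _ (a / b)^-1) ?posrE ?invr_gt0// (@lnV _ (a / b)) ?posrE// expRK.
rewrite -(ler_pM2l a0) mulrBr mulr1.
have -> : a * (b * expR t / a) = b * expR t by field; rewrite gt_eqF.
by rewrite !mulrDr mulrN; lra.
Qed.

(** * Expectations of finitely-valued maps *)

Lemma bounded_integrable (R : realType) (d : measure_display)
    (Omega : measurableType d) (P : probability Omega R) (f : Omega -> R) (M : R) :
  measurable_fun setT f -> (forall w, `|f w| <= M) ->
  P.-integrable setT (EFin \o f).
Proof.
move=> mf fM; apply: measurable_bounded_integrable => //.
  exact: (le_lt_trans (probability_le1 P measurableT) (ltry 1)).
exists M; split; first exact: num_real.
by move=> y My w _; exact: le_trans (fM w) (ltW My).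
Qed.

Lemma Rintegral_sum (R : realType) (d : measure_display)
    (Omega : measurableType d) (P : probability Omega R) (I : finType)
    (f : I -> Omega -> R) :
  (forall i, P.-integrable setT (EFin \o f i)) ->
  P.-integrable setT (EFin \o (fun w => \sum_i f i w)) /\
  \int[P]_w (\sum_i f i w) = \sum_i \int[P]_w f i w.
Proof.
move=> fi.
have fE : EFin \o (fun w => \sum_i f i w) = fun w => (\sum_i (f i w)%:E)%E.
  by apply/funext => w /=; rewrite sumEFin.
split; first by rewrite fE; apply: integrable_sum => // i _; exact: fi.
rewrite /Rintegral (_ : (fun w => _%:E) = EFin \o fun w => \sum_i f i w)//.
by rewrite fE integral_sum// sum_fine// => i _; exact: (integrable_fin_num _ (fi i)).
Qed.

Lemma Rintegral_indic (R : realType) (d : measure_display)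
    (Omega : measurableType d) (P : probability Omega R) (E : set Omega) :
  measurable E -> \int[P]_w (\1_E w) = fine (P E).
Proof. by move=> mE; rewrite /Rintegral integral_indic// setIT. Qed.

Lemma integrable_indicZ (R : realType) (d : measure_display)
    (Omega : measurableType d) (P : probability Omega R) (E : set Omega) (c : R) :
  measurable E -> P.-integrable setT (EFin \o (fun w => c * \1_E w)).
Proof.
move=> mE; apply: (@bounded_integrable _ _ _ _ _ `|c|).
  exact: measurable_funM.
move=> w; rewrite normrM ler_piMr// indicE normr_nat.
by case: (_ \in _).
Qed.

Lemma Rintegral_finType (R : realType) (d : measure_display)
    (Omega : measurableType d) (P : probability Omega R) (K : finType)
    (kappa : Omega -> K) (g : K -> R) :
  (forall k, measurable (kappa @^-1` [set k])) ->
  P.-integrable setT (EFin \o (g \o kappa)) /\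
  \int[P]_w g (kappa w) = \sum_k g k * fine (P (kappa @^-1` [set k])).
Proof.
move=> mk.
have gE : g \o kappa = fun w => \sum_k g k * \1_(kappa @^-1` [set k]) w.
  apply/funext => w /=.
  rewrite (bigD1 (kappa w))//= indicE mem_set// mulr1 big1 ?addr0// => k kw.
  by rewrite indicE memNset ?mulr0// => /= /esym/eqP; exact/negP.
rewrite -[X in \int[P]_w X w]/(g \o kappa) gE.
have [gi ->] := Rintegral_sum (fun k => integrable_indicZ P (g k) (mk k)).
split=> //; apply: eq_bigr => k _; rewrite -Rintegral_indic//.
rewrite RintegralZl//.
by have := integrable_indicZ P 1 (mk k); under eq_fun do rewrite mul1r.
Qed.

(** * The variational lower bound on mutual information for a finite partition *)

(** The fibres of [idx] form one of the partitions in the supremum. [xlnx_young] is applied to each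
    cell of the joint law, the reference mass being that of the product law, [P B / 2]. Summed over
    the two signs, the exponential terms give [P B] times [cosh h * expR (- h ^+ 2 / 2) <= 1]. *)
Lemma mutual_info_ge_discrete (R : realType) (d : measure_display)
    (Omega : measurableType d) (P : probability Omega R)
    (S : Omega -> R) (V : Omega -> bool) (m : nat) (idx : R -> 'I_m)
    (h : 'I_m -> R) :
  measurable_fun setT S -> measurable_fun setT V ->
  P (V @^-1` [set true]) = (2^-1)%:E ->
  (forall j, measurable (idx @^-1` [set j])) ->
  ((\int[P]_w (sgnb (V w) * h (idx (S w)) - h (idx (S w)) ^+ 2 / 2))%:E
    <= mutual_info P S V)%E.
Proof.
move=> mS mV PV midx.
have mVb b : measurable (V @^-1` [set b]) by rewrite -[X in measurable X]setTI; exact: mV.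
have mSB j : measurable (S @^-1` (idx @^-1` [set j])).
  by rewrite -[X in measurable X]setTI; exact: mS.
have fP A : measurable A -> P A \is a fin_num by exact: fin_num_measure.
have PV' b : fine (P (V @^-1` [set b])) = 2^-1.
  case: b; first by rewrite PV.
  have -> : V @^-1` [set false] = ~` (V @^-1` [set true]).
    by apply/seteqP; split => w /=; case: (V w).
  by rewrite probability_setC// PV /=; lra.
apply: (@le_trans _ _ (mi_partition P S V (fun j => idx @^-1` [set j]))%:E); last first.
  apply: ereal_sup_ubound; exists m, (fun j => idx @^-1` [set j]); split => //.
    by move=> i j _ _ [x []/= <- <-].
  by apply/seteqP; split => // x _; exists (idx x).
(* The test function: subtracting [h ^+ 2 / 2] makes the mean of [expR g] under the product law at
   most 1. *)
pose g (k : 'I_m * bool) : R := sgnb k.2 * h k.1 - h k.1 ^+ 2 / 2.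
rewrite lee_fin (_ : \int[P]_w _ = \int[P]_w g (idx (S w), V w))//.
have kE k : (fun w => (idx (S w), V w)) @^-1` [set k] =
    S @^-1` (idx @^-1` [set k.1]) `&` V @^-1` [set k.2].
  by apply/seteqP; split => w; case: k => j b /= [-> ->].
rewrite (Rintegral_finType P g _).2; last by move=> k; rewrite kE; exact: measurableI.
under eq_bigr do rewrite kE.
rewrite -(pair_bigA_idem _ (fun j b =>
  g (j, b) * fine (P (S @^-1` (idx @^-1` [set j]) `&` V @^-1` [set b])))) /=;
  last by rewrite addr0.
apply: ler_sum => j _ /=; rewrite !big_bool /= !PV'.
set B := S @^-1` _.
have BE : fine (P B) = fine (P (B `&` V @^-1` [set true])) + fine (P (B `&` V @^-1` [set false])).
  have mBV b : measurable (B `&` V @^-1` [set b]).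
    by apply: measurableI; [exact: mSB|exact: mVb].
  have B0 : (B `&` V @^-1` [set true]) `&` (B `&` V @^-1` [set false]) = set0.
    by apply/seteqP; split => // w [[_ /= ->] [_]].
  rewrite -fineD ?fP// -measureU//.
  by congr (fine (P _)); apply/seteqP; split => w /=; [case: (V w); tauto|tauto].
have p0 b : 0 <= fine (P (B `&` V @^-1` [set b])) by exact: fine_ge0.
(* For an empty cell the summand is 0 by convention, and the left side is then minus a nonnegative
   number. *)
have main b (t : R) : let p := fine (P (B `&` V @^-1` [set b])) in
   p * (1 + t) - fine (P B) / 2 * expR t <=
   (if p == 0 then 0 else p * ln (p / (fine (P B) / 2))).
  move=> p; have [->|pn0] := eqVneq p 0.
    by rewrite mul0r sub0r oppr_le0 !mulr_ge0 ?expR_ge0// fine_ge0.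
  have pp : 0 < p by rewrite lt_neqAle eq_sym pn0; exact: p0.
  apply: xlnx_young => //; rewrite divr_gt0// BE.
  by apply: lt_le_trans pp _; rewrite /p; case: b {p pn0}; rewrite ?lerDl ?lerDr p0.
(* The two constant terms [p * 1] add up to [P B] by [BE], which pays for the two exponential
   terms. *)
apply: le_trans (lerD (main true (g (j, true))) (main false (g (j, false)))).
rewrite /g /= !mul1r mulN1r; set x := h j.
have := cosh_le_expR_sqr x; set E := expR (x ^+ 2 / 2) => coshE.
have E0 : 0 < E by exact: expR_gt0.
rewrite !expRD expRN -/E.
have : (expR x + expR (- x)) / 2 / E <= 1 by rewrite ler_pdivrMr// mul1r.
move=> /(ler_wpM2l (fine_ge0 (measure_ge0 P B))); rewrite mulr1 {2}BE.
by rewrite -/B; lra.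
Qed.

(** * Passing upper bounds on expectations to the limit *)

(** Dominated convergence. The bound [c] is an extended real because it will be a mutual
    information, possibly infinite. *)
Lemma Rintegral_le_limit (R : realType) (d : measure_display)
    (Omega : measurableType d) (P : probability Omega R)
    (f_ : nat -> Omega -> R) (f g : Omega -> R) (c : \bar R) :
  (forall n, measurable_fun setT (f_ n)) ->
  (forall w, f_ ^~ w @ \oo --> f w) ->
  P.-integrable setT (EFin \o g) ->
  (forall n w, `|f_ n w| <= g w) ->
  (forall n, ((\int[P]_w f_ n w)%:E <= c)%E) ->
  ((\int[P]_w f w)%:E <= c)%E.
Proof.
move=> mf ff ig fg fc.
have fi n : P.-integrable setT (EFin \o f_ n).
  apply: le_integrable ig => //; first exact/measurable_EFinP.
  by move=> w _ /=; rewrite lee_fin (le_trans (fg n w))// ler_norm.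
have mf0 : measurable_fun setT f by apply: (measurable_fun_cvg mf) => w _; exact: ff.
have [|||||fi0 _ fcvg] := @dominated_convergence _ _ _ P _ measurableT
    (fun n => EFin \o f_ n) (EFin \o f) (EFin \o g).
- by move=> n; exact/measurable_EFinP.
- exact/measurable_EFinP.
- by apply: aeW => w _; apply: cvg_EFin; [exact: nearW|exact: ff].
- by [].
- by apply: aeW => w n _; rewrite lee_fin.
rewrite /Rintegral fineK; last exact: integrable_fin_num fi0.
move: (fcvg) => /cvg_lim <-//; apply: lime_le; first exact: cvgP fcvg.
by apply: nearW => n; rewrite -[leLHS]fineK ?fc//; exact: integrable_fin_num (fi n).
Qed.

Lemma sgnb_norm (R : realType) (b : bool) : `|sgnb b : R| = 1.
Proof. by case: b; rewrite /sgnb ?normrN normr1. Qed.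

Lemma measurable_sgnb (R : realType) (d : measure_display)
    (Omega : measurableType d) (V : Omega -> bool) :
  measurable_fun setT V -> measurable_fun setT (fun w => sgnb (V w) : R).
Proof. by move=> mV; exact: measurable_fun_ifT. Qed.

Lemma measurable_quad (R : realType) (d : measure_display)
    (Omega : measurableType d) (V : Omega -> bool) (Y : Omega -> R) :
  measurable_fun setT V -> measurable_fun setT Y ->
  measurable_fun setT (fun w => sgnb (V w) * Y w - Y w ^+ 2 / 2).
Proof.
move=> mV mY; apply: measurable_funB.
  by apply: measurable_funM => //; exact: measurable_sgnb.
by apply: measurable_funM => //; exact: measurable_funX.
Qed.

Lemma Rintegral_quad_le_limit (R : realType) (d : measure_display)
    (Omega : measurableType d) (P : probability Omega R)
    (V : Omega -> bool) (Y_ : nat -> Omega -> R) (Y : Omega -> R) (K : R)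
    (c : \bar R) :
  0 <= K ->
  measurable_fun setT V ->
  (forall n, measurable_fun setT (Y_ n)) ->
  (forall w, Y_ ^~ w @ \oo --> Y w) ->
  P.-integrable setT (EFin \o (fun w => Y w ^+ 2)) ->
  (forall n w, `|Y_ n w| <= `|Y w| + K) ->
  (forall n,
     ((\int[P]_w (sgnb (V w) * Y_ n w - Y_ n w ^+ 2 / 2))%:E <= c)%E) ->
  ((\int[P]_w (sgnb (V w) * Y w - Y w ^+ 2 / 2))%:E <= c)%E.
Proof.
move=> K0 mV mY YY Y2 YM.
(* The dominating function comes from [|z| <= (z ^+ 2 + 1) / 2] and [(|z| + K) ^+ 2 <= 2 * z ^+ 2 +
   2 * K ^+ 2]. *)
apply: (Rintegral_le_limit (g := fun w => 2 * Y w ^+ 2 + (1 + K + K ^+ 2))).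
- by move=> n; exact: measurable_quad.
- move=> w; apply: cvgB; first exact: cvgMr.
  by apply: cvgMl; rewrite expr2; apply: cvgM.
- apply: (@integrableD _ _ _ _ _ _ (fun w => (2 * Y w ^+ 2)%:E)
    (fun=> (1 + K + K ^+ 2)%:E)) => //.
    exact: (@integrableZl _ _ _ _ _ _ 2 (fun w => (Y w ^+ 2)%:E)).
  exact: finite_measure_integrable_cst.
- move=> n w; have := YM n w; set y := Y_ n w; set z := Y w => yz.
  rewrite (le_trans (ler_normB _ _))// normrM sgnb_norm mul1r.
  rewrite normrM normrX [X in _ * X]ger0_norm; last by lra.
  rewrite -(@real_normK _ z) ?num_real//.
  have y2 : `|y| ^+ 2 <= (`|z| + K) ^+ 2 by rewrite lerXn2r ?nnegrE ?addr_ge0.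
  have := sqr_ge0 (`|z| - 1); have := sqr_ge0 (`|z| - K).
  by rewrite sqrrB1 sqrrB sqrrD in y2 *; have := sqr_ge0 `|z|; lra.
Qed.

(** * Truncation and rounding to a finite grid *)

Definition clamp (R : realType) (a x : R) := Num.max (- a) (Num.min a x).

Lemma clamp_dist (R : realType) (a x y : R) :
  `|clamp a x - clamp a y| <= `|x - y|.
Proof.
have xy : x - y <= `|x - y| by exact: ler_norm.
have yx : y - x <= `|x - y| by rewrite distrC; exact: ler_norm.
rewrite ler_norml /clamp !minElt; apply/andP.
split; do 2?[case: ifPn; rewrite -?leNgt => ?]; rewrite !maxElt;
  do ?[case: ifPn; rewrite -?leNgt => ?]; lra.
Qed.

Lemma clamp_id (R : realType) (a x : R) : `|x| <= a -> clamp a x = x.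
Proof.
rewrite ler_norml => /andP[ax xa].
by rewrite /clamp (min_idPr xa) (max_idPr ax).
Qed.

Lemma clamp_le_norm (R : realType) (a x : R) : 0 <= a -> `|clamp a x| <= `|x|.
Proof.
move=> a0; have := clamp_dist a x 0.
by rewrite (@clamp_id _ a 0) ?normr0// !subr0.
Qed.

Lemma clamp_bound (R : realType) (a x : R) : 0 <= a -> - a <= clamp a x <= a.
Proof.
move=> a0; rewrite /clamp le_max lexx/= ge_max ge_min lexx/= andbT; lra.
Qed.

Lemma measurable_clamp (R : realType) (a : R) : measurable_fun setT (clamp a).
Proof. by apply: measurable_maxr => //; exact: measurable_minr. Qed.

(** The interval from [- n.+1] to [n.+1] is cut with mesh [1 / n.+1] into this many steps. Indices
    live in ['I_(grid_size n).+1] because the right endpoint, where large values are clamped, has an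
    index of its own. *)
Definition grid_size (n : nat) := (2 * n.+1 * n.+1)%N.

Definition grid_pos (R : realType) (n : nat) (x : R) : R :=
  n.+1%:R * (clamp n.+1%:R x + n.+1%:R).

Definition grid_idx (R : realType) (n : nat) (x : R) : 'I_(grid_size n).+1 :=
  inord (Num.truncn (grid_pos n x)).

Definition grid_val (R : realType) (n : nat) (j : 'I_(grid_size n).+1) : R :=
  j%:R / n.+1%:R - n.+1%:R.

Lemma grid_pos_bound (R : realType) (n : nat) (x : R) :
  0 <= grid_pos n x <= (grid_size n)%:R.
Proof.
have /andP[] := @clamp_bound _ n.+1%:R x (ler0n _ _).
have := ler0n R n.+1; rewrite /grid_pos /grid_size !natrM.
set M := n.+1%:R; nra.
Qed.

Lemma grid_idxE (R : realType) (n : nat) (x : R) :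
  nat_of_ord (grid_idx n x) = Num.truncn (grid_pos n x).
Proof.
have /andP[p0 pM] := grid_pos_bound n x.
by rewrite /grid_idx inordK// ltnS truncn_le_nat// (le_lt_trans pM) ?ltr_nat.
Qed.

Lemma measurable_grid (R : realType) (n : nat) (j : 'I_(grid_size n).+1) :
  measurable (@grid_idx R n @^-1` [set j]).
Proof.
have -> : @grid_idx R n @^-1` [set j] = @grid_pos R n @^-1` `[j%:R, j.+1%:R[.
  apply/seteqP; split => x /=; rewrite in_itv/=;
    have /andP[p0 _] := grid_pos_bound n x.
    by move=> <-; rewrite grid_idxE truncn_itv.
  by move=> /truncn_def xj; apply/val_inj; rewrite /= grid_idxE.
rewrite -[X in measurable X]setTI.
apply: (_ : measurable_fun setT (@grid_pos R n)) => //.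
apply: measurable_funM => //; apply: measurable_funD => //.
exact: measurable_clamp.
Qed.

Lemma grid_approx (R : realType) (n : nat) (x : R) :
  `|grid_val R (grid_idx n x) - clamp n.+1%:R x| <= n.+1%:R^-1.
Proof.
have /andP[p0 _] := grid_pos_bound n x.
have M0 : 0 < n.+1%:R :> R by rewrite ltr0n.
rewrite /grid_val grid_idxE; have := truncn_itv p0.
set k := Num.truncn _; rewrite -[X in _ < X]natr1 => /andP[lk kl].
have -> : k%:R / n.+1%:R - n.+1%:R - clamp n.+1%:R x =
    (k%:R - grid_pos n x) / n.+1%:R :> R.
  by rewrite /grid_pos; field; rewrite gt_eqF.
rewrite normrM normfV [`|n.+1%:R|]gtr0_norm// ler_piMl ?invr_ge0 ?ler0n//.
by rewrite ler_norml; apply/andP; split; lra.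
Qed.

Definition grid_round (R : realType) (n : nat) (x : R) : R :=
  grid_val R (grid_idx n x).

(** Clamping is 1-Lipschitz and each rounding costs at most one mesh. The bound involves [x - y]
    alone, so rounded increments are dominated by the increment even when [x] and [y] come from
    variables without moments. *)
Lemma grid_round_dist (R : realType) (n : nat) (x y : R) :
  `|grid_round n x - grid_round n y| <= `|x - y| + 2 / n.+1%:R.
Proof.
have := clamp_dist n.+1%:R x y.
have := grid_approx n x; have := grid_approx n y.
rewrite /grid_round !ler_norml; move: n.+1%:R^-1 => k /andP[? ?] /andP[? ?] /andP[? ?].
by apply/andP; split; lra.
Qed.

Lemma grid_round_cvg (R : realType) (x : R) : grid_round n x @[n --> \oo] --> x.
Proof.
apply/cvgrPdist_le => /= e e0.
have [N xN] : exists N : nat, `|x| <= N%:R.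
  by exists (Num.truncn `|x|).+1; rewrite ltW// truncnS_gt.
near=> n.
have nN : (N <= n)%N by near: n; exact: nbhs_infty_ge.
have xn : `|x| <= n.+1%:R by rewrite (le_trans xN)// ler_nat ltnW.
have := grid_approx n x; rewrite clamp_id// distrC => /le_trans; apply.
apply: ltW; near: n; exact: (near_infty_natSinv_lt (PosNum e0)).
Unshelve. all: by end_near. Qed.

Lemma grid_round_le (R : realType) (n : nat) (x : R) :
  `|grid_round n x| <= `|x| + 1.
Proof.
have := grid_approx n x; have := @clamp_le_norm _ n.+1%:R x (ler0n _ _).
have : n.+1%:R^-1 <= 1 :> R by rewrite invf_le1 ?ler1n ?ltr0n.
rewrite -/(grid_round n x); move: n.+1%:R^-1 => k k1 c gc.
have := ler_normD (grid_round n x - clamp n.+1%:R x) (clamp n.+1%:R x).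
rewrite subrK; lra.
Qed.

Lemma measurable_fun_finType (R : realType) (d : measure_display)
    (Omega : measurableType d) (K : finType) (kappa : Omega -> K) (g : K -> R) :
  (forall k, measurable (kappa @^-1` [set k])) ->
  measurable_fun setT (g \o kappa).
Proof.
move=> mk _ B mB; rewrite setTI.
have -> : (g \o kappa) @^-1` B =
    \bigcup_(k in [set k | g k \in B]) (kappa @^-1` [set k]).
  apply/seteqP; split => [w Bw|w [k /= /set_mem gB kw]].
    by exists (kappa w) => //=; exact: mem_set.
  by rewrite /= kw.
by apply: fin_bigcup_measurable => //; exact: finite_finset.
Qed.

(** * The variational lower bound for a square integrable function of [S] *)

(** The value [f (S w)] is rounded rather than [S w]: the cells are preimages under [f], on which
    the rounded function is constant, and its convergence requires no continuity of [f]. *)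
Lemma mutual_info_ge_fun (R : realType) (d : measure_display)
    (Omega : measurableType d) (P : probability Omega R)
    (S : Omega -> R) (V : Omega -> bool) (f : R -> R) :
  measurable_fun setT S -> measurable_fun setT V ->
  P (V @^-1` [set true]) = (2^-1)%:E ->
  measurable_fun setT f ->
  P.-integrable setT (EFin \o (fun w => f (S w) ^+ 2)) ->
  ((\int[P]_w (sgnb (V w) * f (S w) - f (S w) ^+ 2 / 2))%:E
    <= mutual_info P S V)%E.
Proof.
move=> mS mV PV mf fi.
have midx n j : measurable ((@grid_idx R n \o f) @^-1` [set j]).
  rewrite comp_preimage -[X in measurable X]setTI; apply: mf => //.
  exact: measurable_grid.
apply: (@Rintegral_quad_le_limit _ _ _ _ _ (fun n => grid_round n \o (f \o S)) _ 1) => //.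
- move=> n; apply: (measurable_fun_finType (kappa := grid_idx n \o f \o S)) => j.
  by have := mS measurableT _ (midx n j); rewrite setTI.
- by move=> w; exact: grid_round_cvg.
- by move=> n w; exact: grid_round_le.
- move=> n; exact: (mutual_info_ge_discrete (idx := grid_idx n \o f) (@grid_val R n)).
Qed.

(** * Replacing an increment by its conditional expectation along a Markov kernel *)

Section markov_step.
Context (R : realType) (d : measure_display) (Omega : measurableType d).
Variables (P : probability Omega R) (S S' : Omega -> R) (V : Omega -> bool).
Hypotheses (mS : measurable_fun setT S) (mS' : measurable_fun setT S').
Hypothesis mV : measurable_fun setT V.
Hypothesis PV : P (V @^-1` [set true]) = (2^-1)%:E.
Variable k : R.-pker R ~> R.
Hypothesis kP : forall b C D, measurable C -> measurable D ->
  P (V @^-1` [set b] `&` S @^-1` C `&` S' @^-1` D) =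
  (\int[P]_(w in V @^-1` [set b] `&` S @^-1` C) k (S w) D)%E.

Section cells.
Variables (m : nat) (idx : R -> 'I_m).
Hypothesis midx : forall j, measurable (idx @^-1` [set j]).

(** The conditional probability that [S'] lies in cell [l] given [S = s]. *)
Let kap (l : 'I_m) (s : R) : R := fine (k s (idx @^-1` [set l])).

Let kap_le1E l s : (k s (idx @^-1` [set l]) <= 1)%E.
Proof. by rewrite -[leRHS](@prob_kernel _ _ _ _ _ k s); apply: le_measure; rewrite ?inE. Qed.

Let kap_fin l s : k s (idx @^-1` [set l]) \is a fin_num.
Proof. by rewrite ge0_fin_numE// (le_lt_trans (kap_le1E l s))// ltry. Qed.

Let kap_ge0 l s : 0 <= kap l s. Proof. exact: fine_ge0. Qed.

Let kap_le1 l s : kap l s <= 1.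
Proof. by rewrite -lee_fin fineK. Qed.

Let kap_sum s : \sum_l kap l s = 1.
Proof.
have trI : trivIset setT (fun l => idx @^-1` [set l]).
  by move=> i j _ _ [x [/= <- <-]].
have cvr : \bigcup_(l in setT) (idx @^-1` [set l]) = setT.
  by apply/seteqP; split => // x _; exists (idx x).
have := measure_fin_bigcup (k s) finite_finset trI (fun l _ => midx l).
rewrite cvr => /(etrans (esym (@prob_kernel _ _ _ _ _ k s))).
have -> : [set: 'I_m] = [set` index_enum 'I_m].
  by apply/seteqP; split => // l _; exact: mem_index_enum.
rewrite -fsbig_seq ?index_enum_uniq// => /(congr1 fine)/= ->.
by rewrite /kap sum_fine.
Qed.

Let mkap l : measurable_fun setT (kap l \o S).
Proof.
apply: measurableT_comp => //; apply: measurableT_comp => //.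
exact: measurable_kernel.
Qed.

Let mSC j : measurable (S @^-1` (idx @^-1` [set j])).
Proof. by rewrite -[X in measurable X]setTI; exact: mS. Qed.

Let mVb b : measurable (V @^-1` [set b]).
Proof. by rewrite -[X in measurable X]setTI; exact: mV. Qed.

(** Both sides are linear in the finitely many indicators of the cells of [(V, S, S')], and [kP]
    settles each cell. The weight of [l] depends on [S] alone although [phi] may depend on [V]: this
    is the conditional independence of [S'] and [V] given [S]. *)
Lemma Rintegral_markov (phi : bool -> 'I_m -> 'I_m -> R) :
  let F w := \sum_l phi (V w) (idx (S w)) l * kap l (S w) in
  P.-integrable setT (EFin \o F) /\
  \int[P]_w phi (V w) (idx (S w)) (idx (S' w)) = \int[P]_w F w.
Proof.
pose g (c : bool * 'I_m * 'I_m) w : R := phi c.1.1 c.1.2 c.2 *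
  (\1_(V @^-1` [set c.1.1] `&` S @^-1` (idx @^-1` [set c.1.2])) w * kap c.2 (S w)).
have mE b j : measurable (V @^-1` [set b] `&` S @^-1` (idx @^-1` [set j])).
  exact: measurableI.
have i1 c : P.-integrable setT (EFin \o (fun w =>
    \1_(V @^-1` [set c.1.1] `&` S @^-1` (idx @^-1` [set c.1.2])) w * kap c.2 (S w))).
  apply: (@bounded_integrable _ _ _ _ _ 1).
    by apply: measurable_funM => //; exact: mkap.
  move=> w; rewrite normrM indicE normr_nat ger0_norm//.
  by case: (_ \in _); rewrite ?mul1r ?mul0r.
have ig c : P.-integrable setT (EFin \o g c).
  exact: (@integrableZl _ _ _ _ _ _ (phi c.1.1 c.1.2 c.2) _ (i1 c)).
have FE : (fun w => \sum_l phi (V w) (idx (S w)) l * kap l (S w)) =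
    fun w => \sum_c g c w.
  apply/funext => w; rewrite -(pair_bigA_idem _ (fun bj l => g (bj, l) w))/=; last by rewrite addr0.
  rewrite (bigD1 (V w, idx (S w)))//= [X in _ + X]big1 ?addr0; last first.
    move=> [b j] /= bj; apply: big1 => l _; rewrite /g /= indicE memNset ?mul0r ?mulr0//.
    by move=> [/= Vb Sj]; rewrite Vb Sj eqxx in bj.
  by apply: eq_bigr => l _; rewrite /g /= indicE mem_set// mul1r.
move=> F; rewrite {}/F FE; have [? ->] := Rintegral_sum ig; split => //.
pose psi (c : bool * 'I_m * 'I_m) := phi c.1.1 c.1.2 c.2.
have kE c : (fun w => (V w, idx (S w), idx (S' w))) @^-1` [set c] =
    V @^-1` [set c.1.1] `&` S @^-1` (idx @^-1` [set c.1.2]) `&` S' @^-1` (idx @^-1` [set c.2]).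
  by apply/seteqP; split => w; case: c => [[b j] l] /=; [case=> -> -> ->|case=> -[-> ->] ->].
rewrite (_ : \int[P]_w _ = \int[P]_w psi (V w, idx (S w), idx (S' w)))//.
rewrite (Rintegral_finType P psi _).2; last first.
  move=> c; rewrite kE; apply: measurableI => //.
  by rewrite -[X in measurable X]setTI; exact: mS'.
apply: eq_bigr => c _; rewrite kE kP// RintegralZl//; congr (_ * _).
rewrite /Rintegral [in LHS]integral_mkcond; congr fine.
apply: eq_integral => w _.
rewrite patchE indicE; case: ifPn => _; rewrite ?mul1r ?mul0r//.
by rewrite /kap fineK.
Qed.

(** With [f s] the conditional mean of [y] given [S = s], the linear term is preserved, since the
    kernel ignores [V], and the quadratic one decreases by Jensen. As [kap] varies inside a cell,
    [f] need not be a step function, so the bound invoked is the one for general [f]. *)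
Lemma mutual_info_ge_markov_discrete (y : 'I_m -> 'I_m -> R) :
  ((\int[P]_w (sgnb (V w) * y (idx (S w)) (idx (S' w)) -
                y (idx (S w)) (idx (S' w)) ^+ 2 / 2))%:E <= mutual_info P S V)%E.
Proof.
pose f s := \sum_l y (idx s) l * kap l s.
have [iF FE] := Rintegral_markov (fun b j l => sgnb b * y j l - y j l ^+ 2 / 2).
rewrite [X in (X%:E <= _)%E]FE.
have my l : measurable_fun setT (fun s => y (idx s) l).
  exact: (measurable_fun_finType (y^~ l) midx).
have mf : measurable_fun setT f.
  apply: measurable_sum => l; apply: measurable_funM => //.
  by apply: measurableT_comp => //; exact: measurable_kernel.
pose M := \sum_j \sum_l `|y j l|.
have fM s : `|f s| <= M.
  rewrite (le_trans (ler_norm_sum _ _ _))// /M [leRHS](bigD1 (idx s))//=.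
  rewrite ler_wpDr ?sumr_ge0// => [j _|]; first by rewrite sumr_ge0.
  by apply: ler_sum => l _; rewrite normrM [`|kap _ _|]ger0_norm// ler_piMr.
have fi : P.-integrable setT (EFin \o (fun w => f (S w) ^+ 2)).
  apply: (@bounded_integrable _ _ _ _ _ (M ^+ 2)).
    by apply: measurable_funX; exact: measurableT_comp.
  by move=> w; rewrite normrX lerXn2r// nnegrE (le_trans (normr_ge0 _) (fM (S w))).
apply: le_trans (mutual_info_ge_fun mS mV PV mf fi); rewrite lee_fin.
apply: le_Rintegral => //.
  apply: (@bounded_integrable _ _ _ _ _ (M + M ^+ 2 / 2)).
    by apply: measurable_quad => //; exact: measurableT_comp.
  move=> w; rewrite (le_trans (ler_normB _ _))// normrM sgnb_norm mul1r lerD//.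
  rewrite normrM normrX [X in _ * X]ger0_norm ?invr_ge0// ler_wpM2r ?invr_ge0//.
  by rewrite lerXn2r// nnegrE (le_trans (normr_ge0 _) (fM (S w))).
move=> w _; set s := S w; set e := sgnb _.
under eq_bigr do rewrite mulrBl -mulrA.
rewrite sumrB -mulr_sumr -/(f s) lerD2l lerN2.
(* Jensen: [sum_l (y l - f)^2 k_l >= 0] *)
have : 0 <= \sum_l (y (idx s) l - f s) ^+ 2 * kap l s.
  by apply: sumr_ge0 => l _; rewrite mulr_ge0 ?sqr_ge0.
have -> : \sum_l (y (idx s) l - f s) ^+ 2 * kap l s =
    \sum_l y (idx s) l ^+ 2 * kap l s - f s ^+ 2.
  under eq_bigr do rewrite sqrrB mulrDl mulrBl.
  rewrite big_split sumrB /= -mulr_sumr kap_sum mulr1.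
  have -> : \sum_l y (idx s) l * f s *+ 2 * kap l s = f s ^+ 2 *+ 2.
    transitivity ((\sum_l y (idx s) l * kap l s) * (f s *+ 2)).
      by rewrite mulr_suml; apply: eq_bigr => l _; ring.
    by rewrite mulrnAr expr2.
  by rewrite mulr2n; ring.
have -> : \sum_l y (idx s) l ^+ 2 / 2 * kap l s = (\sum_l y (idx s) l ^+ 2 * kap l s) / 2.
  by rewrite mulr_suml; apply: eq_bigr => l _; ring.
by lra.
Qed.

End cells.
End markov_step.

(** * Optimisation over the scaling and the bound for one increment *)

(* The bound by [1 / 2] is needed for [b = 0] and [c = +oo], where [0 * +oo = 0]. *)
Lemma sqrte_ge_quad (R : realType) (a b : R) (c : \bar R) :
  0 <= b -> (forall t, ((t * a - t ^+ 2 * b / 2)%:E <= c)%E) ->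
  (forall t, t * a - t ^+ 2 * b / 2 <= 1 / 2) ->
  (a%:E <= sqrte (2%:E * b%:E * c))%E.
Proof.
move=> b0 abc ab; have [a0|a0] := leP a 0.
  by rewrite (@le_trans _ _ 0%E) ?lee_fin// sqrte_ge0.
have {}b0 : 0 < b.
  (* If [b] were 0, the choice [t = a^-1] would give [1 <= 1 / 2]. *)
  rewrite lt_neqAle b0 andbT; apply/negP => /eqP b00; have := ab a^-1.
  by rewrite -b00 mulr0 mul0r subr0 mulVf ?gt_eqF//; lra.
case: c abc => [r abc| _|/(_ 0)]; last by rewrite leeNy_eq.
  rewrite -!EFinM lee_fin -(ger0_norm (ltW a0)) -sqrtr_sqr ler_wsqrtr//.
  (* The maximiser of the quadratic in [t], with maximum [a ^+ 2 / (2 * b)]. *)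
  have := abc (a / b); rewrite lee_fin.
  have -> : a / b * a - (a / b) ^+ 2 * b / 2 = a ^+ 2 / (2 * b).
    by field; rewrite gt_eqF.
  by rewrite ler_pdivrMr; [rewrite mulrC|rewrite mulr_gt0].
by rewrite -EFinM gt0_muley ?leey// lte_fin mulr_gt0.
Qed.

Lemma integrable_sgnb (R : realType) (d : measure_display)
    (Omega : measurableType d) (P : probability Omega R)
    (V : Omega -> bool) (Y : Omega -> R) :
  measurable_fun setT V -> P.-integrable setT (EFin \o Y) ->
  P.-integrable setT (EFin \o (fun w => sgnb (V w) * Y w)).
Proof.
move=> mV iY; have mY : measurable_fun setT Y.
  by apply/measurable_EFinP; exact: measurable_int iY.
apply: le_integrable iY => //.
  by apply/measurable_EFinP; apply: measurable_funM => //; exact: measurable_sgnb.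
by move=> w _; rewrite lee_fin normrM sgnb_norm mul1r.
Qed.

Lemma integrable_of_sqr (R : realType) (d : measure_display)
    (Omega : measurableType d) (P : probability Omega R) (Y : Omega -> R) :
  measurable_fun setT Y -> P.-integrable setT (EFin \o (fun w => Y w ^+ 2)) ->
  P.-integrable setT (EFin \o Y).
Proof.
move=> mY iY2; apply: (@le_integrable _ _ _ _ _ _ _ (fun w => (Y w ^+ 2 + 1)%:E)) => //.
- exact/measurable_EFinP.
- move=> w _; rewrite lee_fin [leRHS]ger0_norm ?addr_ge0 ?sqr_ge0//.
  rewrite -(@real_normK _ (Y w)) ?num_real//; move: `|Y w| => y.
  by have := sqr_ge0 (y - 1); have := sqr_ge0 y; rewrite sqrrB1; lra.
- apply: (@integrableD _ _ _ _ _ _ (fun w => (Y w ^+ 2)%:E) (fun=> 1%:E)) => //.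
  exact: finite_measure_integrable_cst.
Qed.

(** Replacing [Y] by [t * Y] turns the hypothesis into a quadratic polynomial in [t], whose
    coefficients are the signed mean and the second moment of [Y]. *)
Lemma Rintegral_sgnb_le (R : realType) (d : measure_display)
    (Omega : measurableType d) (P : probability Omega R)
    (V : Omega -> bool) (Y : Omega -> R) (c : \bar R) :
  measurable_fun setT V -> measurable_fun setT Y ->
  P.-integrable setT (EFin \o (fun w => Y w ^+ 2)) ->
  (forall t, ((\int[P]_w (sgnb (V w) * (t * Y w) - (t * Y w) ^+ 2 / 2))%:E <= c)%E) ->
  ((\int[P]_w (sgnb (V w) * Y w))%:E <=
    sqrte (2%:E * (\int[P]_w (Y w ^+ 2)%:E) * c))%E.
Proof.
move=> mV mY iY2 Yc.
have iY := integrable_of_sqr mY iY2.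
have iVY := integrable_sgnb mV iY.
have i1 t : P.-integrable setT (EFin \o (fun w => t * (sgnb (V w) * Y w))).
  exact: (@integrableZl _ _ _ _ _ _ t _ iVY).
have i2 t : P.-integrable setT (EFin \o (fun w => (t ^+ 2 / 2) * Y w ^+ 2)).
  exact: (@integrableZl _ _ _ _ _ _ (t ^+ 2 / 2) _ iY2).
have QE t w : sgnb (V w) * (t * Y w) - (t * Y w) ^+ 2 / 2 =
    t * (sgnb (V w) * Y w) - (t ^+ 2 / 2) * Y w ^+ 2 by ring.
have E t : \int[P]_w (sgnb (V w) * (t * Y w) - (t * Y w) ^+ 2 / 2) =
    t * \int[P]_w (sgnb (V w) * Y w) - t ^+ 2 * (\int[P]_w (Y w ^+ 2)) / 2.
  under eq_Rintegral do rewrite QE.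
  by rewrite RintegralB// !RintegralZl//; ring.
rewrite -[X in (_ * X * _)%E]fineK; last exact: integrable_fin_num iY2.
apply: sqrte_ge_quad.
- by apply: Rintegral_ge0 => w _; exact: sqr_ge0.
- by move=> t; rewrite -E.
(* The uniform bound holds pointwise by completing the square: a sign has square 1, so the gap to
   [1 / 2] is half of a square. *)
- move=> t; rewrite -E; have <- : \int[P]_(w in setT) (1 / 2) = 1 / 2 :> R.
    rewrite Rintegral_cst// -[RHS]mulr1; congr (_ * _).
    exact: (congr1 fine (probability_setT P)).
  apply: le_Rintegral => //.
  + under eq_fun do rewrite QE.
    exact: (@integrableB _ _ _ _ _ _ _ _ (i1 t) (i2 t)).
  + exact: finite_measure_integrable_cst.
  + move=> w _; rewrite -subr_ge0.
    have -> : 1 / 2 - (sgnb (V w) * (t * Y w) - (t * Y w) ^+ 2 / 2) =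
        (sgnb (V w) * (t * Y w) - 1) ^+ 2 / 2.
      by case: (V w); rewrite /sgnb; field.
    by rewrite divr_ge0 ?sqr_ge0.
Qed.

(** Here [S] may have infinite second moment. Its truncations are bounded, so the square-root bound
    with [c = 0] makes their signed means at most 0, and dominated convergence with majorant [|S|]
    removes the truncation. *)
Lemma Rintegral_sgnb_le0 (R : realType) (d : measure_display)
    (Omega : measurableType d) (P : probability Omega R)
    (V : Omega -> bool) (S : Omega -> R) :
  measurable_fun setT S -> measurable_fun setT V ->
  P (V @^-1` [set true]) = (2^-1)%:E ->
  P.-integrable setT (EFin \o S) -> (mutual_info P S V <= 0)%E ->
  \int[P]_w (sgnb (V w) * S w) <= 0.
Proof.
move=> mS mV PV iS I0; rewrite -lee_fin.
have mc n : measurable_fun setT (clamp n%:R \o S).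
  by apply: measurableT_comp => //; exact: measurable_clamp.
have clampn n w : `|clamp n%:R (S w)| <= n%:R.
  by rewrite ler_norml; exact: clamp_bound.
apply: (@Rintegral_le_limit _ _ _ _
    (fun n w => sgnb (V w) * clamp n%:R (S w)) _ (fun w => `|S w|)).
- by move=> n; apply: measurable_funM; [exact: measurable_sgnb|exact: mc].
- move=> w; apply: cvgMr; apply: cvg_near_cst; near=> n.
  apply: clamp_id; near: n; exists (Num.truncn `|S w|).+1 => // n /= Sn.
  by rewrite (le_trans (ltW (truncnS_gt _)))// ler_nat.
- exact: integrable_norm.
- by move=> n w; rewrite normrM sgnb_norm mul1r clamp_le_norm.
- move=> n.
  have i2 (t : R) : P.-integrable setT (EFin \o (fun w => (t * clamp n%:R (S w)) ^+ 2)).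
    apply: (@bounded_integrable _ _ _ _ _ ((`|t| * n%:R) ^+ 2)).
      by apply: measurable_funX; apply: measurable_funM => //; exact: mc.
    by move=> w; rewrite normrX lerXn2r ?nnegrE ?mulr_ge0// normrM ler_wpM2l.
  apply: le_trans (Rintegral_sgnb_le (c := 0%E) mV (mc n) _ _) _.
  + by have := i2 1; under eq_fun do rewrite mul1r.
  + move=> t; apply: le_trans I0.
    apply: (mutual_info_ge_fun (f := fun x => t * clamp n%:R x)) => //.
    by apply: measurable_funM => //; exact: measurable_clamp.
  + by rewrite mule0 sqrte0.
Unshelve. all: by end_near. Qed.

(** [S] and [S'] are rounded on the same grid, which makes the discrete Markov bound applicable. The
    rounded increments, scaled by [t], exceed the scaled true one by at most [2 * |t|] in absolute
    value, so square integrability of the increment suffices for the limit. *)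
Lemma Rintegral_sgnb_markov_le (R : realType) (d : measure_display)
    (Omega : measurableType d) (P : probability Omega R)
    (S S' : Omega -> R) (V : Omega -> bool) (k : R.-pker R ~> R) :
  measurable_fun setT S -> measurable_fun setT S' -> measurable_fun setT V ->
  P (V @^-1` [set true]) = (2^-1)%:E ->
  (forall b C D, measurable C -> measurable D ->
    P (V @^-1` [set b] `&` S @^-1` C `&` S' @^-1` D) =
    (\int[P]_(w in V @^-1` [set b] `&` S @^-1` C) k (S w) D)%E) ->
  P.-integrable setT (EFin \o (fun w => (S w - S' w) ^+ 2)) ->
  ((\int[P]_w (sgnb (V w) * (S w - S' w)))%:E <=
    sqrte (2%:E * (\int[P]_w ((S w - S' w) ^+ 2)%:E) * mutual_info P S V))%E.
Proof.
move=> mS mS' mV PV kP i2.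
have mY : measurable_fun setT (S \- S') by exact: measurable_funB.
apply: Rintegral_sgnb_le => // t.
apply: (@Rintegral_quad_le_limit _ _ _ _ _
  (fun n w => t * (grid_round n (S w) - grid_round n (S' w))) _ (2 * `|t|)) => //.
- have mg n (f : Omega -> R) : measurable_fun setT f ->
      measurable_fun setT (grid_round n \o f).
    move=> mf; apply: measurableT_comp => //.
    exact: (measurable_fun_finType (@grid_val R n) (@measurable_grid R n)).
  by move=> n; apply: measurable_funM => //; apply: measurable_funB; exact: mg.
- by move=> w; apply: cvgMr; apply: cvgB; exact: grid_round_cvg.
- under eq_fun do rewrite exprMn.
  exact: (@integrableZl _ _ _ _ _ _ (t ^+ 2) _ i2).
- move=> n w; rewrite !normrM [2 * _]mulrC -mulrDr ler_wpM2l//.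
  rewrite (le_trans (grid_round_dist _ _ _))// lerD2l.
  by rewrite ler_pdivrMr ?ltr0n// ler_peMr// ler1n.
- move=> n; exact: (mutual_info_ge_markov_discrete mS mS' mV PV kP (@measurable_grid R n)
    (fun i j => t * (grid_val R i - grid_val R j))).
Qed.

(** * Telescoping along a stochastic chain *)

(** At a nonzero time [t] the process takes different values for the two signs, so it reveals [V]
    and [V = b] is one of its events. The constraint on [T] is dropped by taking the whole line. *)
Lemma markov4_sign_kernel (R : realType) (d : measure_display)
    (Omega : measurableType d) (P : probability Omega R)
    (Gamma : set R) (V : Omega -> bool) (T S S' : Omega -> R) (t : R) :
  Gamma t -> t != 0 -> markov4 P (proc_events Gamma V) T S S' ->
  exists k : R.-pker R ~> R, forall b C D, measurable C -> measurable D ->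
    P (V @^-1` [set b] `&` S @^-1` C `&` S' @^-1` D) =
    (\int[P]_(w in V @^-1` [set b] `&` S @^-1` C) k (S w) D)%E.
Proof.
move=> Gt t0 [_ [k kP]]; exists k => b C D mC mD.
have Vb : proc_events Gamma V (V @^-1` [set b]).
  apply: sub_sigma_algebra; exists t => //; exists [set sgnb b * t] => //.
  rewrite setTI; apply/seteqP; split => w /= [].
    by move=> /(mulIf t0); rewrite /sgnb; case: (V w); case: b => //; lra.
  by move=> ->.
by have := kP _ setT C D Vb measurableT mC mD; rewrite preimage_setT setIT.
Qed.

Section chain.
Context (R : realType) (d : measure_display) (Omega : measurableType d).
Variables (P : probability Omega R) (V : Omega -> bool).
Variables (k0 : nat) (Tc : nat -> Omega -> R).
Hypothesis mV : measurable_fun setT V.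
Hypothesis PV : P (V @^-1` [set true]) = (2^-1)%:E.
Hypothesis mTc : forall k, measurable_fun setT (Tc k).

Let term k : \bar R :=
  sqrte (2%:E * (\int[P]_w ((Tc k w - Tc k.-1 w) ^+ 2)%:E)
              * mutual_info P (Tc k) V)%E.

Let term_ge0 k : (0 <= term k)%E. Proof. exact: sqrte_ge0. Qed.

Let ET k : \bar R := (\int[P]_w (sgnb (V w) * Tc k w)%:E)%E.

(** A finite value of the extended integral of a measurable function forces absolute integrability,
    and the sign does not change absolute values. This recovers integrability of [T_k] from
    convergence of the means. *)
Lemma integrable_sgnb_fin (T : Omega -> R) : measurable_fun setT T ->
  (\int[P]_w (sgnb (V w) * T w)%:E)%E \is a fin_num ->
  P.-integrable setT (EFin \o T).
Proof.
move=> mT; have msT : measurable_fun setT (fun w => sgnb (V w) * T w).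
  by apply: measurable_funM => //; exact: measurable_sgnb.
rewrite -integral_fin_num_abs// => Tfin; apply/integrableP; split.
  exact/measurable_EFinP.
apply: le_lt_trans Tfin; rewrite le_eqVlt; apply/orP; left; apply/eqP.
by apply: eq_integral => w _ /=; rewrite normrM sgnb_norm mul1r.
Qed.

(* [T_k] need not be integrable for intermediate [k]: if the increment is not
   square integrable its term is infinite unless [T_k] is independent of [V],
   and then [T_k], if integrable, contributes nothing. *)
Lemma chain_partial_le (j : nat) :
  ET k0 = 0%E ->
  (forall k, (k0 < k)%N ->
    exists ker : R.-pker R ~> R, forall b C D, measurable C -> measurable D ->
    P (V @^-1` [set b] `&` Tc k @^-1` C `&` Tc k.-1 @^-1` D) =
    (\int[P]_(w in V @^-1` [set b] `&` Tc k @^-1` C) ker (Tc k w) D)%E) ->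
  P.-integrable setT (EFin \o Tc (k0 + j)) ->
  ((\int[P]_w (sgnb (V w) * Tc (k0 + j) w))%:E <=
   \sum_(k0.+1 <= k < (k0 + j).+1) term k)%E.
Proof.
move=> E0 kP; elim: j => [|j IH] iT.
  by rewrite addn0 big_geq// /Rintegral -/(ET k0) E0.
rewrite addnS in iT *; set K := (k0 + j)%N in IH iT *.
have kK : (k0 < K.+1)%N by rewrite ltnS leq_addr.
rewrite big_nat_recr//=.
have s0 : (0 <= \sum_(k0.+1 <= k < K.+1) term k)%E by exact: sume_ge0.
have [I0|I0] := leP (mutual_info P (Tc K.+1) V) 0%E.
  rewrite (@le_trans _ _ 0%E)//; last by rewrite adde_ge0.
  by rewrite lee_fin; exact: Rintegral_sgnb_le0 (mTc _) mV PV iT I0.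
have m2 : measurable_fun setT (fun w => (Tc K.+1 w - Tc K w) ^+ 2).
  by apply: measurable_funX; exact: measurable_funB.
(* The mutual information is now strictly positive, so an infinite second moment makes the last term
   [+oo]; the convention [+oo * 0 = 0] cannot interfere. *)
have [D2|D2] := ltP (\int[P]_w ((Tc K.+1 w - Tc K w) ^+ 2)%:E)%E +oo%E; last first.
  rewrite /term /= (_ : \int[P]_w _ = +oo)%E; last by apply/eqP; rewrite -leye_eq.
  by rewrite gt0_muley ?lte_fin// gt0_mulye//= addey ?leey// gt_eqF// (lt_le_trans _ s0)// ltNy0.
have i2 : P.-integrable setT (EFin \o (fun w => (Tc K.+1 w - Tc K w) ^+ 2)).
  apply/integrableP; split; first exact/measurable_EFinP.
  by under eq_integral do rewrite /= ger0_norm ?sqr_ge0//.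
have iD : P.-integrable setT (EFin \o (Tc K.+1 \- Tc K)).
  by apply: integrable_of_sqr => //; exact: measurable_funB.
(* Integrability is passed down the chain: from [T_(K+1)] and the increment to [T_K], as the
   induction hypothesis demands. *)
have iK : P.-integrable setT (EFin \o Tc K).
  have := @integrableB _ _ _ _ _ measurableT _ _ iT iD.
  by apply: eq_integrable => // w _ /=; rewrite -EFinB; congr EFin; rewrite opprB addrC subrK.
have [ker kerP] := kP _ kK.
have step := Rintegral_sgnb_markov_le (mTc _) (mTc _) mV PV kerP i2.
apply: le_trans (leeD (IH iK) step); rewrite -EFinD lee_fin -RintegralD//.
- by rewrite le_eqVlt; apply/orP; left; apply/eqP/eq_Rintegral => w _; ring.
- exact: integrable_sgnb.
- exact: (integrable_sgnb (Y := Tc K.+1 \- Tc K)).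
Qed.

(** The limit of the means is finite because [T] is integrable, so the means are eventually finite
    and the corresponding [T_k] integrable. Each such mean is bounded by a partial sum, hence by the
    series of nonnegative terms. *)
Lemma stochastic_chain_le (Gamma : set R) (T : Omega -> R) :
  P.-integrable setT (EFin \o T) ->
  stochastic_chain P Gamma V T k0 Tc ->
  ((\int[P]_w (sgnb (V w) * T w))%:E <= \sum_(k0.+1 <= k <oo) term k)%E.
Proof.
move=> iT [GT [cvgT [E0 mk]]].
have iVT := integrable_sgnb mV iT.
rewrite /Rintegral fineK; last exact: integrable_fin_num iVT.
have fin_near : \forall k \near \oo, ET k \is a fin_num.
  move: cvgT; rewrite -[X in _ --> X]fineK; last exact: integrable_fin_num iVT.
  by move=> /fine_cvgP[].
have S0 : (0 <= \sum_(k0.+1 <= k <oo) term k)%E by exact: nneseries_ge0.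
move: (cvgT) => /cvg_lim <-//; apply: lime_le; first exact: cvgP cvgT.
(* If [Gamma] has no nonzero point the process says nothing about [V], but then the chain, with
   values in [Gamma], vanishes identically. *)
have [[t [Gt t0]]|G0] := pselect (exists t, Gamma t /\ t != 0).
  near=> k.
  have k0k : (k0 <= k)%N by near: k; exact: nbhs_infty_ge.
  have kfin : ET k \is a fin_num by near: k.
  have ik := integrable_sgnb_fin (mTc k) kfin.
  rewrite -[leLHS]fineK// -/(Rintegral _ _ _).
  apply: (@le_trans _ _ (\sum_(k0.+1 <= i < k.+1) term i)%E); last first.
    exact: nneseries_lim_ge.
  rewrite -(subnKC k0k); apply: chain_partial_le; rewrite ?subnKC//.
  move=> i k0i; exact: markov4_sign_kernel Gt t0 (mk i k0i).
near=> k.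
have k0k : (k0 <= k)%N by near: k; exact: nbhs_infty_ge.
have Tk0 w : Tc k w = 0.
  by apply/eqP/negP => /negP T0; apply: G0; exists (Tc k w); split => //; exact: GT.
by under eq_integral do rewrite Tk0 mulr0; rewrite integral0.
Unshelve. all: by end_near. Qed.

End chain.

(** * Independence of generated sigma-algebras and laws of independent pairs *)

Lemma probability_bigcup (R : realType) (d : measure_display)
    (Omega : measurableType d) (P : probability Omega R) (X : nat -> set Omega) :
  (forall n, measurable (X n)) -> trivIset setT X ->
  P (\bigcup_n X n) = (\sum_(n <oo) P (X n))%E.
Proof.
move=> mX trX; rewrite measure_bigcup//.
by apply: eq_eseriesl => // n; rewrite in_setT.
Qed.

Lemma probability_partition (R : realType) (d : measure_display)
    (Omega : measurableType d) (P : probability Omega R) (K : finType)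
    (kappa : Omega -> K) (E : set Omega) :
  (forall k, measurable (kappa @^-1` [set k])) -> measurable E ->
  fine (P E) = \sum_k fine (P (E `&` kappa @^-1` [set k])).
Proof.
move=> mk mE; have mEk k : measurable (E `&` kappa @^-1` [set k]).
  exact: measurableI.
have EE : \1_E = (fun w => \sum_k \1_(E `&` kappa @^-1` [set k]) w) :> (_ -> R).
  apply/funext => w; rewrite (bigD1 (kappa w))//= big1 => [|k kw].
    by rewrite addr0 !indicE in_setI [w \in _ @^-1` _]mem_set// andbT.
  by rewrite indicE memNset// => -[_ /= /esym/eqP]; exact/negP.
rewrite -Rintegral_indic// EE.
have i1 k : P.-integrable setT (EFin \o (\1_(E `&` kappa @^-1` [set k]) : _ -> R)).
  by have := integrable_indicZ P 1 (mEk k); under eq_fun do rewrite mul1r.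
rewrite (Rintegral_sum i1).2; apply: eq_bigr => k _; exact: Rintegral_indic.
Qed.

(** Dynkin's pi-lambda argument: the events [X] independent of [D] form a lambda-system containing a
    pi-system that generates the sigma-algebra of all families except [k0]. *)
Lemma mutually_independent_sigma (R : realType) (d : measure_display)
    (Omega : measurableType d) (P : probability Omega R) (K : finType)
    (F : K -> set (set Omega)) (k0 : K) (E D : set Omega) :
  mutually_independent P F ->
  (forall k, F k `<=` measurable) ->
  (forall k, setI_closed (F k)) -> (forall k, F k setT) ->
  <<s \bigcup_(k in [set k | k != k0]) F k >> E -> F k0 D ->
  P (E `&` D) = (P E * P D)%E.
Proof.
move=> indep mF FI FT sE FD.
have mD : measurable D by exact: mF FD.
(* The pi-system: intersections of one event from each family other than [k0]. A single event
   belongs to it by taking [setT] in the other families. *)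
pose G : set (set Omega) := [set X | exists2 A : K -> set Omega,
  forall k, F k (A k) & X = \bigcap_(k in [set k | k != k0]) A k].
pose H : set (set Omega) := [set X | measurable X /\ P (X `&` D) = (P X * P D)%E].
suff GH : <<s G >> `<=` H.
  apply: (GH E _).2; move: sE; apply: sub_sigma_algebra2.
  move=> X [k /= kk0 FX]; exists (fun l => if l == k then X else setT).
    by move=> l; case: eqP => [->|].
  apply/seteqP; split => [w Xw l _|w /(_ k kk0)]; last by rewrite eqxx.
  by case: eqP.
apply: lambda_system_subset => //.
- move=> _ _ [A FA ->] [B FB ->]; exists (fun k => A k `&` B k).
    by move=> k; exact: FI.
  by rewrite bigcapI.
- apply/dynkin_lambda_system; split.
  + by split => //; rewrite setTI probability_setT mul1e.
  + move=> X [mX XD]; split; first exact: measurableC.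
    rewrite setIC -setDE; transitivity (P D - P (D `&` X))%E.
      by apply: measureD => //; rewrite ltey_eq fin_num_measure.
    by rewrite [D `&` X]setIC XD probability_setC// muleBl ?mul1e ?fin_num_measure.
  + move=> X trX HX; have mX n : measurable (X n) := (HX n).1.
    have mUX : measurable (\bigcup_n X n) by exact: bigcupT_measurable.
    split => //; rewrite setI_bigcupl !probability_bigcup//; last 2 first.
    + by move=> n; exact: measurableI.
    + exact: trivIset_setIr.
    rewrite -(@fineK _ (P D)) ?fin_num_measure// muleC -nneseriesZl//.
    by apply: eq_eseriesr => n _; rewrite fineK ?fin_num_measure// muleC; exact: (HX n).2.
- move=> X [A FA ->]; have mA k : measurable (A k) by exact: mF (FA k).
  pose A' k := if k == k0 then D else A k.
  have FA' k : F k (A' k) by rewrite /A'; case: eqP => [->|].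
  have mcap : measurable (\bigcap_(k in [set k | k != k0]) A k).
    by apply: fin_bigcap_measurable => //; exact: finite_finset.
  split => //.
  (* The product formula is used twice, with [D] inserted at [k0] and with [k0] left out; the two
     products differ by the factor [P D]. *)
  have e1 := indep [set: K]%SET A' (fun k _ => FA' k).
  have e2 := indep [set~ k0]%SET A (fun k _ => FA k).
  rewrite -[LHS]fineK ?fin_num_measure//; last exact: measurableI.
  rewrite -[in RHS](@fineK _ (P D)) ?fin_num_measure//.
  rewrite -[in RHS](@fineK _ (P (bigcap _ _))) ?fin_num_measure//.
  rewrite -EFinM; congr EFin; rewrite mulrC.
  have -> : \bigcap_(k in [set k | k != k0]) A k `&` D =
      \bigcap_(k in [set k | k \in finset.setTfor K]) A' k.
    apply/seteqP; split => [w [Aw Dw] k _|w A'w].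
      by rewrite /A'; case: eqP => [//|/eqP kk0]; exact: Aw.
    split => [k /= kk0|]; have := A'w _ (finset.in_setT _).
      by move=> /(_ k); rewrite /A' (negbTE kk0).
    by move=> /(_ k0); rewrite /A' eqxx.
  have -> : [set k | k != k0] = [set k | k \in [set~ k0]%SET].
    by apply/seteqP; split => k /=; rewrite !inE.
  rewrite e1 e2 (bigD1 k0) ?finset.in_setT//= {1}/A' eqxx; congr (_ * _).
  apply: eq_big => k; first by rewrite !inE.
  by rewrite /A' => /andP[_ /negbTE ->].
Qed.

(** Factorisation on rectangles identifies the law of [(X, N)] with the product of the law of [X]
    and [mu], by uniqueness of the product measure; Tonelli's theorem gives the iterated
    integral. *)
Lemma integral_indep_pair (R : realType) (d dA dB : measure_display)
    (Omega : measurableType d) (TA : measurableType dA) (TB : measurableType dB)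
    (P : probability Omega R) (mu : probability TB R)
    (X : Omega -> TA) (N : Omega -> TB) (f : TA * TB -> \bar R) :
  measurable_fun setT X -> measurable_fun setT N ->
  (forall B C, measurable B -> measurable C ->
    P (X @^-1` B `&` N @^-1` C) = (P (X @^-1` B) * mu C)%E) ->
  measurable_fun setT f -> (forall p, (0 <= f p)%E) ->
  (\int[P]_w \int[mu]_z f (X w, z) = \int[P]_w f (X w, N w))%E.
Proof.
move=> mX mN XN mf f0.
have mXN : measurable_fun setT (fun w => (X w, N w)) by exact: measurable_fun_pair.
pose Xp : {mfun Omega >-> TA} := HB.pack X (isMeasurableFun.Build _ _ _ _ _ mX).
pose XNp : {mfun Omega >-> (TA * TB)%type} :=
  HB.pack (fun w => (X w, N w)) (isMeasurableFun.Build _ _ _ _ _ mXN).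
pose PX := distribution P Xp; pose PXN := distribution P XNp.
transitivity (\int[PX]_x \int[mu]_z f (x, z))%E.
  rewrite /PX /distribution ge0_integral_pushforward//.
    exact: measurable_fun_fubini_tonelli_F.
  by move=> x _; exact: integral_ge0.
rewrite -(fubini_tonelli1 (m1 := PX) (m2 := mu))//.
transitivity (\int[PXN]_p f p)%E; last first.
  by rewrite /PXN /distribution ge0_integral_pushforward.
apply: eq_measure_integral => E mE _.
apply: (product_measure_unique (m1 := PX) (m2 := mu) (m' := PXN)) => //.
Qed.

(** * The supersample: ghost points and the decomposition of the error *)

Section supersample.
Context (R : realType) (d : measure_display) (Omega : measurableType d).
Context (dZ dW dS : measure_display) (Z : measurableType dZ)
  (Wsp : measurableType dW) (Seed : measurableType dS) (n : nat).
Variables (P : probability Omega R) (mu : probability Z R).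
Variables (A : n.-tuple Z -> Seed -> Wsp) (loss : Wsp -> Z -> R).
Variables (Zt : 'I_n -> bool -> Omega -> Z) (U : 'I_n -> Omega -> bool)
  (Rs : Omega -> Seed).
Hypothesis mA : measurable_fun setT (fun p : n.-tuple Z * Seed => A p.1 p.2).
Hypothesis loss0 : forall w z, 0 <= loss w z.
Hypothesis mloss : measurable_fun setT (fun p : Wsp * Z => loss p.1 p.2).
Hypothesis mZt : forall i j, measurable_fun setT (Zt i j).
Hypothesis mU : forall i, measurable_fun setT (U i).
Hypothesis mRs : measurable_fun setT Rs.
Hypothesis Ztmu : forall i j B, measurable B -> P (Zt i j @^-1` B) = mu B.
Hypothesis indep : mutually_independent P (ss_family Zt U Rs).

Let W := hyp A Zt U Rs.

(* [pick i id] is the training point of index [i], [pick i negb] its test point. *)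
Let pick i (s : bool -> bool) w := Zt i (s (U i w)) w.

Let mpick i s : measurable_fun setT (pick i s).
Proof.
rewrite /pick (_ : (fun w => _) =
    fun w => if U i w then Zt i (s true) w else Zt i (s false) w); last first.
  by apply/funext => w; case: (U i w).
exact: measurable_fun_ifT.
Qed.

Let mW : measurable_fun setT W.
Proof.
rewrite (_ : W = (fun p => A p.1 p.2) \o (fun w => (train_sample Zt U w, Rs w)))//.
apply: measurableT_comp => //; apply: measurable_fun_pair => //.
apply/measurable_fun_tnthP => i.
rewrite (_ : _ \o _ = pick i id)//.
by apply/funext => w; rewrite /= tnth_mktuple.
Qed.

(** On the event that all selectors equal [u], the hypothesis is the function [Wu] of the entries
    [Zt j (u j)] and the seed, while the test point is the entry [(i, ~~ u i)], which [Wu] never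
    reads. Independence then holds for each [u], and summing over [u] gives the claim. *)
Lemma hyp_ghost_indep i B C : measurable B -> measurable C ->
  P (W @^-1` B `&` pick i negb @^-1` C) = (P (W @^-1` B) * mu C)%E.
Proof.
move=> mB mC.
pose kappa w := [ffun j => U j w].
have mUb j b : measurable (U j @^-1` [set b]).
  by rewrite -[X in measurable X]setTI; exact: mU.
have kE u : kappa @^-1` [set u] =
    \bigcap_(j in [set` 'I_n]) U j @^-1` [set u j].
  apply/seteqP; split => w /=; first by move=> <- j _; rewrite /= ffunE.
  by move=> wu; apply/ffunP => j; rewrite ffunE; exact: (wu j isT).
have mk u : measurable (kappa @^-1` [set u]).
  by rewrite kE; apply: fin_bigcap_measurable => //; exact: finite_finset.
have mWB : measurable (W @^-1` B) by rewrite -[X in measurable X]setTI; exact: mW.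
have mNC : measurable (pick i negb @^-1` C).
  by rewrite -[X in measurable X]setTI; exact: mpick.
have fP E : measurable E -> P E \is a fin_num by exact: fin_num_measure.
rewrite -[LHS]fineK ?fP//; last exact: measurableI.
rewrite -[X in (X * _)%E]fineK ?fP// -[X in (_ * X)%E]fineK ?fin_num_measure//.
rewrite -EFinM; congr EFin.
rewrite (probability_partition P mk) ?(probability_partition P mk mWB); last exact: measurableI.
rewrite mulr_suml; apply: eq_bigr => u _.
pose Wu w := A [tuple Zt j (u j) w | j < n] (Rs w).
have WuE w : kappa w = u -> W w = Wu w.
  move=> ku; rewrite /W /hyp /Wu; congr A; apply/eq_from_tnth => j.
  by rewrite !tnth_mktuple -ku ffunE.
pose k0 : ('I_n * bool) + ('I_n + unit) := inl (i, ~~ u i).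
pose FF := \bigcup_(k in [set k | k != k0]) ss_family Zt U Rs k.
have E1 : W @^-1` B `&` kappa @^-1` [set u] = kappa @^-1` [set u] `&` Wu @^-1` B.
  by apply/seteqP; split => w /= [h1 h2]; split => //; [rewrite -WuE|rewrite WuE].
have -> : W @^-1` B `&` pick i negb @^-1` C `&` kappa @^-1` [set u] =
    (kappa @^-1` [set u] `&` Wu @^-1` B) `&` Zt i (~~ u i) @^-1` C.
  rewrite -E1; apply/seteqP; split => w /=.
    by move=> [[h1 h2] h3]; split => //; move: h2; rewrite /pick -h3 ffunE.
  by move=> [[h1 h3] h2]; split => //; split => //; move: h2; rewrite /pick -h3 ffunE.
rewrite E1 (mutually_independent_sigma (F := ss_family Zt U Rs) (k0 := k0))//.
- by rewrite Ztmu// fineM// fin_num_measure// -E1; exact: measurableI.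
- move=> k X; case: k => [[j b]|[j|[]]] [Y mY <-]; [exact: mZt|exact: mU|exact: mRs].
- move=> k X Y; case: k => [[j b]|[j|[]]] [X' mX' <-] [Y' mY' <-];
    by rewrite !setTI -preimage_setI; exists (X' `&` Y'); rewrite ?setTI//; exact: measurableI.
- by move=> k; case: k => [[j b]|[j|[]]]; exists setT; rewrite ?setTI ?preimage_setT.
(* [O] is [Omega] with the sigma-algebra generated by all families except that of the test point, so
   that membership in it becomes a measurability question. *)
- pose O := g_sigma_algebraType FF.
  have sub k X : k != k0 -> ss_family Zt U Rs k X -> measurable (X : set O).
    by move=> kk0 FX; apply: sub_sigma_algebra; exists k.
  have mO dT (T : measurableType dT) (f : Omega -> T) k : k != k0 ->
      ss_family Zt U Rs k = sigma_rv f -> measurable_fun setT (f : O -> T).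
    by move=> kk0 kf _ Y mY; apply: (sub k) => //; rewrite kf; exists Y.
  have mWu : measurable_fun setT (Wu : O -> Wsp).
    rewrite (_ : Wu = (fun p => A p.1 p.2) \o
      (fun w => ([tuple Zt j (u j) w | j < n], Rs w)))//.
    apply: measurableT_comp => //; apply: measurable_fun_pair; last first.
      exact: (mO _ _ _ (inr (inr tt))).
    apply/measurable_fun_tnthP => j.
    rewrite (_ : _ \o _ = Zt j (u j)); last first.
      by apply/funext => w; rewrite /= tnth_mktuple.
    apply: (mO _ _ _ (inl (j, u j))) => //.
    (* A training entry [(j, u j)] is never the test entry [(i, ~~ u i)]. *)
    by apply/eqP => -[-> /eqP]; case: (u i).
  have mkO : measurable (kappa @^-1` [set u] : set O).
    rewrite kE; apply: fin_bigcap_measurable => [|j _]; first exact: finite_finset.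
    rewrite -[X in measurable X]setTI.
    exact: (mO _ _ _ (inr (inl j))).
  apply: (measurableI (kappa @^-1` [set u] : set O) _ mkO).
  by rewrite -[X in measurable X]setTI; exact: mWu.
- by exists C; rewrite ?setTI.
Qed.

Let ltest i w := loss (W w) (pick i negb w).
Let ltrain i w := loss (W w) (Zt i (U i w) w).

Let mloss_pick i s : measurable_fun setT (fun w => loss (W w) (pick i s w)).
Proof.
rewrite (_ : (fun w => _) =
  (fun p : Wsp * Z => loss p.1 p.2) \o (fun w => (W w, pick i s w)))//.
by apply: measurableT_comp => //; exact: measurable_fun_pair.
Qed.

(** The unselected entry of any row [i] can play the role of the fresh point [Z'], being independent
    of the hypothesis and of law [mu]. *)
Lemma L_mu_ghost i :
  L_mu P mu A loss Zt U Rs = (\int[P]_w (ltest i w)%:E)%E.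
Proof.
apply: (integral_indep_pair (f := fun p => (loss p.1 p.2)%:E) mW (mpick i negb)).
- by move=> B C mB mC; exact: hyp_ghost_indep.
- exact/measurable_EFinP.
- by move=> p; rewrite lee_fin.
Qed.

Hypothesis n0 : (0 < n)%N.
Hypothesis Lmu_fin : (L_mu P mu A loss Zt U Rs < +oo)%E.
Hypothesis Ln_fin : (L_n P A loss Zt U Rs < +oo)%E.

Let iltest i : P.-integrable setT (EFin \o ltest i).
Proof.
apply/integrableP; split; first exact/measurable_EFinP/(mloss_pick i negb).
move: Lmu_fin; rewrite (L_mu_ghost i); apply: le_lt_trans.
rewrite le_eqVlt; apply/orP; left; apply/eqP; apply: eq_integral => w _ /=.
by rewrite ger0_norm//; exact: loss0.
Qed.

Let iltrain i : P.-integrable setT (EFin \o ltrain i).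
Proof.
have msum : measurable_fun setT (fun w => n%:R^-1 * \sum_(j < n) ltrain j w).
  apply: measurable_funM => //; apply: measurable_sum => j.
  exact: (mloss_pick j id).
have sum0 w : 0 <= \sum_(j < n) ltrain j w by apply: sumr_ge0 => j _; exact: loss0.
have iavg : P.-integrable setT
    (EFin \o (fun w => n%:R^-1 * \sum_(j < n) ltrain j w)).
  apply/integrableP; split; first exact/measurable_EFinP.
  move: Ln_fin; apply: le_lt_trans.
  rewrite le_eqVlt; apply/orP; left; apply/eqP; apply: eq_integral => w _ /=.
  by rewrite ger0_norm// mulr_ge0 ?invr_ge0.
(* The losses are nonnegative, so one training loss is at most their sum, which is [n] times the
   integrable average. *)
apply: (le_integrable _ _ _ (integrableZl _ n%:R iavg)) => //.
  exact/measurable_EFinP/(mloss_pick i id).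
move=> w _; rewrite /= lee_fin mulrA mulfV ?mul1r; last first.
  by rewrite pnatr_eq0 -lt0n.
rewrite !ger0_norm ?loss0// (bigD1 i)//= lerDl.
by apply: sumr_ge0 => j _; exact: loss0.
Qed.

(** The sign of [true] is [-1], so the signed difference is always oriented as test loss minus
    training loss. *)
Let sgnb_DeltaL i w :
  sgnb (U i w) * DeltaL A loss Zt U Rs i w = ltest i w - ltrain i w.
Proof.
rewrite /DeltaL /ltest /ltrain /pick -/W.
by case: (U i w); rewrite /sgnb /= ?mul1r// mulN1r opprB.
Qed.

Lemma integrable_DeltaL i :
  P.-integrable setT (EFin \o DeltaL A loss Zt U Rs i).
Proof.
have -> : DeltaL A loss Zt U Rs i =
    fun w => sgnb (U i w) * (ltest i w - ltrain i w).
  apply/funext => w; rewrite -sgnb_DeltaL mulrA.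
  by case: (U i w); rewrite /sgnb ?mulrNN !mul1r.
apply: integrable_sgnb => //.
exact: (@integrableB _ _ _ _ _ measurableT _ _ (iltest i) (iltrain i)).
Qed.

(** Each row contributes the same [L_mu] through its ghost point, and the training losses average to
    [L_n]. *)
Lemma Err_DeltaL : Err P mu A loss Zt U Rs =
  n%:R^-1 * \sum_(i < n) \int[P]_w (sgnb (U i w) * DeltaL A loss Zt U Rs i w).
Proof.
have nn0 : n%:R != 0 :> R by rewrite pnatr_eq0 -lt0n.
have -> : \sum_(i < n) \int[P]_w (sgnb (U i w) * DeltaL A loss Zt U Rs i w) =
    \sum_(i < n) (fine (L_mu P mu A loss Zt U Rs) - \int[P]_w ltrain i w).
  apply: eq_bigr => i _; under eq_Rintegral do rewrite sgnb_DeltaL.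
  by rewrite RintegralB// (L_mu_ghost i).
rewrite sumrB sumr_const card_ord mulrBr -[X in _ * X - _]mulr_natl mulrA mulVf//.
rewrite mul1r; congr (_ - _); have [isum <-] := Rintegral_sum iltrain.
by rewrite -RintegralZl.
Qed.

End supersample.

(** * Averaging the chain bounds over the rows of the supersample *)

Unset Implicit Arguments.

Theorem theorem4 (R : realType) (d : measure_display) (Omega : measurableType d)
  (P : probability Omega R)
  (dX dY dW dS : measure_display) (X : measurableType dX) (Y : measurableType dY)
  (Wsp : measurableType dW) (Seed : measurableType dS) (n : nat)
  (mu : probability (X * Y)%type R)
  (A : n.-tuple (X * Y)%type -> Seed -> Wsp) (loss : Wsp -> (X * Y)%type -> R)
  (Zt : 'I_n -> bool -> Omega -> (X * Y)%type) (U : 'I_n -> Omega -> bool)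
  (Rs : Omega -> Seed) (k0 : nat) (Tc : 'I_n -> nat -> Omega -> R) :
  (0 < n)%N ->
  (* the learning algorithm and the loss *)
  measurable_fun setT (fun p : n.-tuple (X * Y)%type * Seed => A p.1 p.2) ->
  (forall w z, 0 <= loss w z) ->
  measurable_fun setT (fun p : Wsp * (X * Y)%type => loss p.1 p.2) ->
  (* the supersample: Z~_{i,j} i.i.d. mu, U uniform on {0,1}^n, seed,
     all mutually independent *)
  (forall i j, measurable_fun setT (Zt i j)) ->
  (forall i, measurable_fun setT (U i)) ->
  measurable_fun setT Rs ->
  (forall i j B, measurable B -> P (Zt i j @^-1` B) = mu B) ->
  (forall i, P (U i @^-1` [set true]) = (2^-1)%:E) ->
  mutually_independent P (ss_family Zt U Rs) ->
  (* Err is well defined *)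
  (L_mu P mu A loss Zt U Rs < +oo)%E ->
  (L_n P A loss Zt U Rs < +oo)%E ->
  (* stochastic chains *)
  (forall i, forall k, measurable_fun setT (Tc i k)) ->
  (forall i, stochastic_chain P (range (DeltaL A loss Zt U Rs i)) (U i)
                (DeltaL A loss Zt U Rs i) k0 (Tc i)) ->
  ((Err P mu A loss Zt U Rs)%:E <=
   (n%:R^-1)%:E *
   \sum_(i < n) \sum_(k0.+1 <= k <oo)
      sqrte (2%:E * (\int[P]_w ((Tc i k w - Tc i k.-1 w) ^+ 2)%:E)
                  * mutual_info P (Tc i k) (U i)))%E.
Proof.
move=> n0 mA loss0 mloss mZt mU mRs Ztmu PU indep Lmu_fin Ln_fin mTc chain.
rewrite (Err_DeltaL mA loss0 mloss mZt mU mRs Ztmu indep n0 Lmu_fin Ln_fin).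
rewrite EFinM -sumEFin lee_wpmul2l ?lee_fin ?invr_ge0//.
apply: lee_sum => i _.
apply: (stochastic_chain_le (mU i) (PU i) (mTc i) _ (chain i)).
exact: (integrable_DeltaL mA loss0 mloss mZt mU mRs Ztmu indep n0 Lmu_fin Ln_fin).
Qed.
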